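(* There exists a function $f:\mathbb{N}\times\mathbb{N}\to\mathbb{N}$ such that for every $h\geq 1$ and $t\geq 1$, every poset $P$ of height at most $h$ whose cover graph $G$ contains no $\leq\!(2h-3)$-subdivision of $K_t$ as a subgraph satisfies $$\dim(P)\leq (3c)^{f(h,t)},$$ where $c:=\operatorname{wcol}_{4h-4}(G)$.
   Context: Graphs and posets are finite and nonempty. A $\leq\!k$-subdivision of a graph $H$ is a subdivision of $H$ in which each edge of $H$ is subdivided at most $k$ times. $K_t$ is the complete graph on $t$ vertices. The height of a poset is the maximum size of a chain in it. An element $y$ covers an element $x$ in $P$ if $x<y$ in $P$ and there is no $z$ with $x<z<y$ in $P$. The cover graph of $P$ is the undirected graph on the elements of $P$ whose edges are the pairs $\{x,y\}$ such that one of $x,y$ covers the other. The dimension $\dim(P)$ is the least $d$ such that the set $\operatorname{Inc}(P)$ of ordered pairs $(x,y)$ of incomparable elements of $P$ can be partitioned into $d$ reversible sets, where $I\subseteq \operatorname{Inc}(P)$ is reversible if some linear extension $L$ of $P$ satisfies $x>y$ in $L$ for all $(x,y)\in I$; if $\operatorname{Inc}(P)=\emptyset$ then $\dim(P)=1$. Weak coloring numbers: let $G$ be a graph, $\pi$ a linear order on $V(G)$, and $r\geq 0$ an integer. A vertex $u$ is weakly $r$-reachable from $v$ w.r.t. $\pi$ if there is a path of length at most $r$ (number of edges) from $v$ to $u$ in $G$ whose smallest vertex w.r.t. $\pi$ is $u$. Let $\operatorname{WReach}_r^{\pi}[v]$ be the set of vertices weakly $r$-reachable from $v$ (it contains $v$).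 The weak $r$-coloring number is $\operatorname{wcol}_r(G):=\min_{\pi}\max_{v\in V(G)}|\operatorname{WReach}_r^{\pi}[v]|$, the minimum being over all linear orders $\pi$ on $V(G)$. *)

(* Defs.v *)
From HB Require Import structures.
From mathcomp Require Import all_boot all_order all_algebra.
Set Implicit Arguments. Unset Strict Implicit. Unset Printing Implicit Defensive.
Import Order.TTheory.

Record sgraph := SGraph {
  vertex :> finType;
  adj : rel vertex;
  adj_sym : symmetric adj;
  adj_irr : irreflexive adj }.

Definition subgraph_of (H G : sgraph) : Prop :=
  exists2 j : H -> G, injective j & forall x y, adj x y -> adj (j x) (j y).

Fact complete_sym t : symmetric (fun i j : 'I_t => i != j).
Proof. by move=> i j; rewrite eq_sym. Qed.

Fact complete_irr t : irreflexive (fun i j : 'I_t => i != j).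
Proof. by move=> i; rewrite eqxx. Qed.

Definition complete_graph (t : nat) : sgraph :=
  SGraph (@complete_sym t) (@complete_irr t).

(** Every edge is listed once, oriented along the enumeration of the vertices. *)
Definition sd_edge (H : sgraph) : finType :=
  {p : H * H | adj p.1 p.2 && (enum_rank p.1 < enum_rank p.2)}.

Section Subdivision.
Variables (H : sgraph) (s : sd_edge H -> nat).

Definition sd_vertex : finType := (H + {p : sd_edge H & 'I_(s p)})%type.

(** The path replacing [p = (u, v)] is [sd_pt p 0 = u], [sd_pt p 1], ...,
    [sd_pt p (s p)], [sd_pt p (s p).+1 = v]. *)
Definition sd_pt (p : sd_edge H) (i : nat) : sd_vertex :=
  if i is j.+1 then
    if insub j is Some o then inr (Tagged (fun q => 'I_(s q)) (o : 'I_(s p)))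
    else inl (val p).2
  else inl (val p).1.

Definition sd_adj : rel sd_vertex := fun x y =>
  [exists p : sd_edge H, exists i : 'I_(s p).+1,
     ((x, y) == (sd_pt p i, sd_pt p i.+1)) ||
     ((y, x) == (sd_pt p i, sd_pt p i.+1))].

Fact sd_adj_sym : symmetric sd_adj.
Proof.
by move=> x y; apply: eq_existsb => p; apply: eq_existsb => i; rewrite orbC.
Qed.

Fact sd_adj_irr : irreflexive sd_adj.
Proof.
move=> x; apply/negbTE/negP; rewrite /sd_adj => /existsP[p /existsP[[i Hi]]].
rewrite orbb => /eqP[-> /=]; case: i Hi => [|i] /= Hi.
  case: insubP => // _; case: p Hi => [[u v] /= /andP[uv _]] _ [E].
  by rewrite E adj_irr in uv.
case: insubP => [o _ oE|]; last by rewrite -ltnS Hi.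
case: insubP => [o' _ o'E|//] E.
have := congr1 (fun z : sd_vertex => if z is inr q then val (tagged q) else 0) E.
by move=> /= /eqP; rewrite oE o'E eqn_leq ltnn andbF.
Qed.

Definition subdivision : sgraph := SGraph sd_adj_sym sd_adj_irr.

End Subdivision.

(** [k] is an integer: for [k < 0] only edgeless graphs have a subdivision in
    which every edge is subdivided at most [k] times. *)
Definition contains_le_subdivision (k : int) (H G : sgraph) : Prop :=
  exists2 s : sd_edge H -> nat,
    forall p, ((s p)%:Z <= k)%R & subgraph_of (subdivision s) G.

(** A linear order is encoded by the set [L] of pairs [(x, y)] with [x <= y]. *)
Definition linear_order (T : finType) (L : {set T * T}) : bool :=
  [&& [forall x, forall y, ((x, y) \in L) || ((y, x) \in L)],
      [forall x, forall y, ((x, y) \in L) && ((y, x) \in L) ==> (x == y)]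
    & [forall x, forall y, forall z,
         ((x, y) \in L) && ((y, z) \in L) ==> ((x, z) \in L)]].

Section KeyOrder.
Variables (T : finType) (k : T -> nat).

Definition key_order : {set T * T} :=
  [set p | if k p.1 == k p.2 then enum_rank p.1 <= enum_rank p.2
           else k p.1 < k p.2].

Fact key_order_linear : linear_order key_order.
Proof.
apply/and3P; split; apply/forallP => x; apply/forallP => y; first 1 last.
- apply/implyP; rewrite !inE /= (eq_sym (k y)).
  case: ltngtP => //= _ /anti_leq/ord_inj/enum_rank_inj->; exact: eqxx.
- apply/forallP => z; apply/implyP; rewrite !inE /=.
  case: (ltngtP (k x) (k y)) => // [xy|->]; case: (ltngtP (k y) (k z)) => //=.
  + by move=> yz _; have := ltn_trans xy yz; case: ltngtP.
  + by move=> <-; case: ltngtP xy.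
  + by rewrite andbF.
  + by move=> _ /andP[]; apply: leq_trans.
rewrite !inE /= (eq_sym (k y)).
by case: ltngtP => //= _; exact: leq_total.
Qed.

End KeyOrder.

Definition wreach (G : sgraph) (pi : {set G * G}) (r : nat) (v : G) : {set G} :=
  [set u | [exists n : 'I_r.+1, exists p : n.-tuple G,
     [&& uniq (v :: p), path (@adj G) v p, last v p == u
       & all (fun w => (u, w) \in pi) (v :: p)]]].

Definition wcol_attained (G : sgraph) (r c : nat) : bool :=
  [exists pi : {set G * G},
     linear_order pi && (\max_(v : G) #|wreach pi r v| == c)].

Fact ex_wcol (G : sgraph) (r : nat) : exists c, wcol_attained G r c.
Proof.
exists (\max_(v : G) #|wreach (key_order (fun=> 0)) r v|).
by apply/existsP; exists (key_order (fun=> 0)); rewrite key_order_linear /=.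
Qed.

Definition wcol (r : nat) (G : sgraph) : nat := ex_minn (ex_wcol G r).

Section Poset.
Context {d : Order.disp_t} (P : finPOrderType d).

Definition chain (C : {set P}) : bool :=
  [forall x in C, forall y in C, (x >=< y)%O].

Definition height : nat := \max_(C : {set P} | chain C) #|C|.

Definition covers (y x : P) : bool :=
  (x < y)%O && ~~ [exists z, (x < z < y)%O].

Definition cover_adj : rel P := fun x y => covers x y || covers y x.

Fact cover_adj_sym : symmetric cover_adj.
Proof. by move=> x y; rewrite /cover_adj orbC. Qed.

Fact cover_adj_irr : irreflexive cover_adj.
Proof. by move=> x; rewrite /cover_adj /covers ltxx. Qed.

Definition cover_graph : sgraph := SGraph cover_adj_sym cover_adj_irr.

Definition Inc : {set P * P} := [set p | (p.1 >< p.2)%O].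

Definition linear_extension (L : {set P * P}) : bool :=
  linear_order L && [forall x, forall y, (x <= y)%O ==> ((x, y) \in L)].

Definition reversible (I : {set P * P}) : bool :=
  [exists L : {set P * P}, linear_extension L &&
     [forall p in I, (p.1 != p.2) && ((p.2, p.1) \in L)]].

Definition reversible_partition (d : nat) : bool :=
  [exists Q : {set {set P * P}},
     [&& partition Q Inc, [forall I in Q, reversible I] & #|Q| == d]].

Fact reversible_pair (p : P * P) : p \in Inc -> reversible [set p].
Proof.
case: p => x y; rewrite inE /= => xy.
have [nxy nyx] : ~~ (x <= y)%O /\ ~~ (y <= x)%O.
  by move: xy; rewrite /Order.comparable negb_or => /andP.
pose R (a b : P) := (a <= b)%O || ((a <= y)%O && (x <= b)%O).
have R_trans a b c : R a b -> R b c -> R a c.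
  rewrite /R => /orP[ab|/andP[ay xb]] /orP[bc|/andP[by_ xc]].
  - by rewrite (le_trans ab bc).
  - by rewrite (le_trans ab by_) xc orbT.
  - by rewrite ay (le_trans xb bc) orbT.
  - by rewrite ay xc orbT.
have R_anti a b : R a b -> R b a -> a = b.
  rewrite /R => /orP[ab|/andP[ay xb]] /orP[ba|/andP[by_ xa]].
  - by apply/le_anti; rewrite ab.
  - by rewrite (le_trans xa (le_trans ab by_)) in nxy.
  - by rewrite (le_trans xb (le_trans ba ay)) in nxy.
  - by rewrite (le_trans xa ay) in nxy.
pose k b := #|[set a | R a b]|.
have kP a b : R a b -> (a, b) \in key_order k.
  move=> ab; have [->|neq] := eqVneq a b; first by rewrite inE /= eqxx.
  have : k a < k b; last by rewrite inE /=; case: ltngtP.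
  apply/proper_card/properP; split.
    by apply/subsetP => c; rewrite !inE => /R_trans; apply.
  exists b; rewrite !inE /R ?lexx //; apply: contra neq => ba.
  by apply/eqP/R_anti.
apply/existsP; exists (key_order k); apply/andP; split.
  rewrite /linear_extension key_order_linear; apply/forallP => a.
  by apply/forallP => b; apply/implyP => ab; apply: kP; rewrite /R ab.
apply/forall_inP => q /set1P -> /=; apply/andP; split.
  by apply: contraNneq nxy => ->.
by apply: kP; rewrite /R !lexx orbT.
Qed.

Fact ex_reversible_partition : exists d, reversible_partition d.
Proof.
exists #|preim_partition id Inc|; apply/existsP.
exists (preim_partition id Inc); rewrite preim_partitionP eqxx andbT /=.
apply/forall_inP => _ /imsetP[p pI ->].
suff -> : [set q in Inc | id p == id q] = [set p] by apply: reversible_pair.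
apply/setP => q; rewrite !inE /= [p == q]eq_sym.
by have [->|_] := eqVneq q p; rewrite ?andbF // andbT; rewrite inE in pI.
Qed.

Definition poset_dim : nat :=
  if Inc == set0 then 1 else ex_minn ex_reversible_partition.

End Poset.

(* Main.v *)
Require Import Defs.
From HB Require Import structures.
From mathcomp Require Import all_boot all_order all_algebra.
From mathcomp Require Import zify.
Set Implicit Arguments.
Unset Strict Implicit.
Unset Printing Implicit Defensive.

(** Let [rk] be a ranking of the elements that attains the weak colouring number
    [c] of radius [4 * h - 4]. A comparability [x <= y] is witnessed by a chain of
    covers of at most [h - 1] edges; if [w] is the element of smallest rank in
    the interval [[x, y]], then [w] is weakly reachable from [x] and from [y]. A set
    of incomparable pairs is reversible unless it contains pairs [(x_i, y_i)]
    with [x_i <= y_(i+1)] cyclically. The plan is to attach to each incomparable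
    pair a signature with polynomially many values in [c], such that no such
    cycle exists among pairs of equal signature ([equal_signature_no_cycle]).
    The classes of equal signature then partition the incomparable pairs into
    reversible sets ([poset_dim_le_signature]).

    The excluded subdivision enters through [hitting_set]. Let [T] be an
    antichain of [t] elements. For [x] below all of [T], the chains from [x] to
    the elements of [T] form a fan, and a fan connects any two elements of [T] by a path
    with at most [2 * h - 3] inner vertices. Fewer than [t ^ 2] fans can be
    disjoint, for otherwise they would form a subdivided complete graph on [T].
    So boundedly many elements meet all fans, and every such [x] is below an element
    of a small set depending only on [T] that is strictly below a member of
    [T].

    From this each [x] obtains a list of bounded length
    ([ex_small_cofinal_lists]) with the property that every [w] of smallest rank
    in [[x, w]] is above a member of the list of [x], and this member belongs to
    a set of [c ^ O(1)] candidates determined by [w] alone. The list is grown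
    while maintaining an antichain [T]. Small antichains are extended by the
    element of smallest rank not above [T], and antichains of size [t] are moved
    down with the hitting set. Since heights are bounded, the process ends.
    The converse order gives lists for the elements [y] of second coordinates.

    Each candidate set is small, so the listed elements can be coloured with
    [c ^ O(1)] colours such that an element is distinguished from the candidates
    of the vertices weakly reachable from it ([conflict_coloring]). The signature
    of [(x, y)] records these colours along both lists and, for each pair of positions,
    the comparison of the ranks of two elements determined by the colours: the
    witness [u] that [x] would use and the witness [v] that [y] would use at
    these positions. In a cycle of pairs with equal signature take the smallest
    witness [w]. At the positions where it is found, the colours force the
    witness of [x_i] to be that of [y_(i+1)] whenever one of the two is below [w]
    in rank ([relevant_propagate]), while the recorded comparison between the
    witnesses of [x_i] and [y_i] always goes the same way. Hence the ranks
    decrease forever along the cycle or against it, which is impossible. *)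

(** * Counting *)

Lemma leq_expl m n k : m <= n -> m ^ k <= n ^ k.
Proof. by case: k => // k; rewrite leq_exp2r. Qed.

Lemma leq_bin_exp n m : 'C(n, m) <= n ^ m.
Proof.
apply: (@leq_trans (n ^_ m)).
  by rewrite -bin_ffact leq_pmulr ?fact_gt0.
elim: m n => [|m IH] n //.
case: n => [|n]; first by rewrite ffact0n.
rewrite ffactnS expnS leq_mul2l /=.
by apply: leq_trans (IH n) _; apply: leq_expl.
Qed.

Lemma card_bigcup_le (I T : finType) (A : {pred I}) (F : I -> {set T}) :
  #|\bigcup_(i in A) F i| <= \sum_(i in A) #|F i|.
Proof.
elim/big_rec2: _ => [|i n B _ IH]; first by rewrite cards0.
by rewrite (leq_trans (leq_card_setU _ _)) // leq_add2l.
Qed.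

(** * Walks bounded in rank *)

Section Reach.
Variables (G : sgraph) (rk : G -> nat).

(** A walk, not a path, and a lower bound [m] on the ranks that need not be
    attained: in this form the relation is symmetric and composes by adding
    lengths. Weak [r]-reachability of [u] from [v] is [reach r (rk u) v u]. *)
Definition reach n m (x y : G) : Prop :=
  exists p, [/\ path (@adj G) x p, last x p = y, size p <= n
              & all (fun z => m <= rk z) (x :: p)].

Lemma reach_trans n1 n2 m x y z :
  reach n1 m x y -> reach n2 m y z -> reach (n1 + n2) m x z.
Proof.
move=> [p [pp lp sp ap]] [q [pq lq sq aq]]; exists (p ++ q); split.
- by rewrite cat_path pp lp.
- by rewrite last_cat lp.
- by rewrite size_cat leq_add.
- by move: aq; rewrite -cat_cons all_cat ap /= => /andP[].
Qed.

Lemma reach_sym n m x y : reach n m x y -> reach n m y x.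
Proof.
move=> [p [pp lp sp ap]]; exists (rev (belast x p)); split.
- rewrite -lp rev_path; apply: sub_path pp => a b.
  by rewrite adj_sym.
- by case: p {pp sp ap} lp => [//|a p] _ /=; rewrite rev_cons last_rcons.
- by rewrite size_rev size_belast.
- by rewrite -lp -rev_rcons -lastI all_rev.
Qed.

Lemma reach_le n1 n2 m x y : n1 <= n2 -> reach n1 m x y -> reach n2 m x y.
Proof. by move=> le [p [pp lp sp ap]]; exists p; split=> //; apply: leq_trans le. Qed.

Lemma mem_wreach (pi : {set G * G}) r u v :
  (forall w, rk u <= rk w -> (u, w) \in pi) ->
  reach r (rk u) v u -> u \in wreach pi r v.
Proof.
move=> rkP [p [pp lp sp ap]]; rewrite inE.
case/shortenP: pp lp => q pq uq sq lq.
have sqr : size q < r.+1.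
  rewrite ltnS (leq_trans _ sp) //; apply: uniq_leq_size sq.
  by case/andP: uq.
apply/existsP; exists (Ordinal sqr); apply/existsP; exists (in_tuple q).
apply/and4P; split=> //; first by rewrite lq.
apply/allP => w; rewrite inE => wq; apply: rkP.
move/allP: ap; apply; rewrite inE; case/orP: wq => [->//|/sq ->].
by rewrite orbT.
Qed.

End Reach.

(** * Subdivisions from disjoint paths *)

Section Embedding.
Variables (H G : sgraph) (k : int) (a : H -> G) (q : sd_edge H -> seq G).

Lemma subdivision_of_paths :
  injective a ->
  (forall p, path (@adj G) (a (val p).1) (rcons (q p) (a (val p).2))) ->
  (forall p, uniq (q p)) ->
  (forall p i, a i \notin q p) ->
  (forall p p' z, z \in q p -> z \in q p' -> p = p') ->
  (forall p, ((size (q p))%:Z <= k)%R) ->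
  contains_le_subdivision k H G.
Proof.
move=> ainj qpath quniq qa qdisj qsize.
exists (fun p => size (q p)) => //.
pose s p := size (q p).
pose j (v : sd_vertex s) : G :=
  match v with
  | inl i => a i
  | inr o => nth (a (val (tag o)).1) (q (tag o)) (tagged o)
  end.
have jmem o : j (inr o) \in q (tag o) by apply: mem_nth; case: (tagged o).
exists j.
  move=> [i|[p o]] [i'|[p' o']] /= E.
  - by rewrite (ainj _ _ E).
  - by case/negP: (qa p' i); rewrite E; apply: (jmem (existT _ p' o')).
  - by case/negP: (qa p i'); rewrite -E; apply: (jmem (existT _ p o)).
  - have pp : p = p'.
      apply: (qdisj _ _ _ (jmem (existT _ p o))); rewrite /= E.
      exact: (jmem (existT _ p' o')).
    subst p'; congr (inr (existT _ p _)); apply/val_inj/eqP.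
    by rewrite -(nth_uniq (a (val p).1) _ _ (quniq p)) ?E ?eqxx //;
       [case: o {E} | case: o' {E}].
have jpt p i : i <= (s p).+1 ->
    j (sd_pt s p i) = nth (a (val p).1) (a (val p).1 :: rcons (q p) (a (val p).2)) i.
  case: i => [//|i] /=; rewrite ltnS => ile.
  case: insubP => [o _ oE|] /=; first by rewrite oE nth_rcons -oE;
    case: o {oE} => /= o ->.
  by rewrite -leqNgt nth_rcons => ge; rewrite ltnNge ge /= eqn_leq ge ile.
have edge p (i : 'I_(s p).+1) : adj (j (sd_pt s p i)) (j (sd_pt s p i.+1)).
  rewrite !jpt ?ltn_ord // 1?ltnW ?ltn_ord //.
  by have /(pathP (a (val p).1)) := qpath p; apply; rewrite size_rcons ltn_ord.
move=> x y /existsP[p /existsP[i /orP[] /eqP[-> ->]]]; first exact: edge.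
by rewrite adj_sym edge.
Qed.

End Embedding.

Lemma contains_complete1 (G : sgraph) k : 0 < #|G| ->
  contains_le_subdivision k (complete_graph 1) G.
Proof.
case/card_gt0P => x0 _.
have noedge (p : sd_edge (complete_graph 1)) : False.
  by have /andP[/=] := valP p; rewrite !ord1.
apply: (@subdivision_of_paths _ _ _ (fun _ => x0) (fun _ => [::])) => //;
  try by move=> p; case: (noedge p).
by move=> i j; rewrite !ord1.
Qed.

(** * Lists of bounded length below all witnesses *)

Section Lists.
Variables (G : sgraph) (rk : G -> nat) (le : rel G) (h : nat).
Hypothesis le_refl : reflexive le.
Hypothesis le_anti : antisymmetric le.
Hypothesis le_trans : transitive le.
Variable ch : G -> G -> seq G.
Hypothesis chP : forall x y, le x y ->
  [/\ path (@adj G) x (ch x y), last x (ch x y) = y, size (ch x y) < h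
    & all (fun z => le x z && le z y) (ch x y)].
Hypothesis height_le : forall C : {set G},
  {in C &, forall x y, le x y || le y x} -> #|C| <= h.

Lemma chain_reach m x y : le x y ->
  (forall z, le x z -> le z y -> m <= rk z) -> reach rk h.-1 m x y.
Proof.
move=> xy mP; have [pp lp sp /allP ap] := chP xy; exists (ch x y); split=> //.
  by lia.
apply/allP => z; rewrite inE => /orP[/eqP->|/ap/andP[]]; last exact: mP.
exact: mP.
Qed.

(** Every chain from [x] to [u] stays in the interval [[x, u]], so minimality of
    the rank at [u] on this interval makes [u] weakly reachable from [x]. *)
Definition lowest x u := le x u && [forall z, le x z && le z u ==> (rk u <= rk z)].

Lemma lowestP x u : reflect (le x u /\ forall z, le x z -> le z u -> rk u <= rk z)
  (lowest x u).
Proof.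
apply: (iffP andP) => [] [xu H]; split=> //.
  by move=> z xz zu; apply: (implyP (forallP H z)); rewrite xz.
by apply/forallP => z; apply/implyP => /andP[]; apply: H.
Qed.

Lemma lowest_refl x : lowest x x.
Proof.
apply/lowestP; split=> // z xz zx.
by rewrite (@le_anti x z) ?xz.
Qed.

Lemma ex_lowest x z : le x z -> exists u, [/\ lowest x u, le u z &
  forall z', le x z' -> le z' z -> rk u <= rk z'].
Proof.
move=> xz; pose I := [pred u | le x u && le u z].
have Ix : I x by rewrite /= le_refl.
case: (arg_minnP rk Ix) => u /andP[xu uz] umin; exists u; split=> //.
  apply/lowestP; split=> // z' xz' z'u; apply: umin.
  by rewrite /= xz' (le_trans z'u).
by move=> z' xz' z'z; apply: umin; rewrite /= xz'.
Qed.

Definition upchain x (C : {set G}) :=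
  [forall y in C, le x y && [forall z in C, le y z || le z y]].

Lemma upchainP x (C : {set G}) :
  reflect ({in C, forall y, le x y} /\ {in C &, forall y z, le y z || le z y})
    (upchain x C).
Proof.
apply: (iffP forall_inP) => [H|[H1 H2] y yC].
  split=> [y /H/andP[]//|y z /H/andP[_ /forall_inP H' /H'//]].
by rewrite H1 //=; apply/forall_inP => z; apply: H2.
Qed.

(** Strictly decreasing along the order and at most [h]: it bounds how often
    one can move down in the construction of lists. *)
Definition level x := \max_(C : {set G} | upchain x C) #|C|.

Lemma level_le x : level x <= h.
Proof. by apply/bigmax_leqP => C /upchainP[_]; apply: height_le. Qed.

Lemma level_lt x y : le x y -> x != y -> level y < level x.
Proof.
move=> xy neq.
have up0 : upchain y set0 by apply/upchainP; split=> z; rewrite inE.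
rewrite {1}/level (bigmax_eq_arg set0) //.
case: arg_maxnP => // C /upchainP[yC CC] _.
have xC : x \notin C.
  by apply: contra neq => /yC yx; apply/eqP/le_anti; rewrite xy.
have -> : #|C|.+1 = #|x |: C| by rewrite cardsU1 xC.
apply: (leq_bigmax_cond (F := fun C : {set G} => #|C|)).
have lx z : z \in x |: C -> le x z.
  by case/setU1P => [->//|/yC]; apply: le_trans.
apply/upchainP; split=> // z z' zC z'C.
case/setU1P: zC z'C => [->|zC]; first by move=> /lx ->.
by case/setU1P=> [->|z'C]; [rewrite lx ?orbT // inE zC orbT | exact: CC].
Qed.

Variable t : nat.
Hypothesis no_sub :
  ~ contains_le_subdivision ((2 * h)%:Z - 3)%R (complete_graph t) G.

Section Hitting.
Variable T : {set G}.
Hypothesis cardT : #|T| = t.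
Hypothesis antiT : {in T &, forall a b, le a b -> a = b}.
Hypothesis t_gt1 : 1 < t.

Let below x := [forall a in T, le x a].

(** [T] is removed so that fans can be disjoint: two disjoint fans yield paths
    between elements of [T] that meet at most at their ends. *)
Definition fan x : {set G} := [set z | [exists a in T, z \in x :: ch x a]] :\: T.

Lemma fan_le x z : below x -> z \in fan x ->
  exists2 a, a \in T & [/\ le x z, le z a & z != a].
Proof.
move=> /forall_inP bx; rewrite !inE => /andP[zT /exists_inP[a aT]].
move=> zin; exists a => //; have xa := bx a aT.
have za : z != a by apply: contraNneq zT => ->.
move: zin; rewrite inE => /orP[/eqP zx|]; first by subst z.
by have [_ _ _ /allP ap] := chP xa; move/ap => /andP[].
Qed.

Lemma below_notin x : below x -> x \notin T.
Proof.
move=> /forall_inP bx; apply/negP => xT.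
have /card_gt0P[b] : 0 < #|T :\ x|.
  by move: (cardsD1 x T); rewrite xT cardT; lia.
by rewrite !inE => /andP[bx' bT]; move: (antiT xT bT (bx b bT)) bx' => ->; rewrite eqxx.
Qed.

Lemma mem_fan x : below x -> x \in fan x.
Proof.
move=> bx; rewrite !inE below_notin //=.
have /card_gt0P[b bT] : 0 < #|T| by rewrite cardT; lia.
by apply/exists_inP; exists b; rewrite // inE eqxx.
Qed.

Lemma card_fan x : below x -> #|fan x| <= t * h.
Proof.
move=> /forall_inP bx; apply: leq_trans (subset_leq_card (subsetDl _ _)) _.
have -> : [set z | [exists a in T, z \in x :: ch x a]] =
    \bigcup_(a in T) [set z in x :: ch x a].
  apply/setP => z; rewrite inE; apply/exists_inP/bigcupP => [] [a aT].
    by exists a; rewrite // inE.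
  by rewrite inE => ?; exists a.
rewrite -cardT -sum_nat_const.
apply: leq_trans (card_bigcup_le _ _) _; apply: leq_sum => a aT.
rewrite cardsE; apply: leq_trans (card_size _) _ => /=.
by have [] := chP (bx a aT).
Qed.


(** Go down the chain from [x] to [a] backwards, up the chain from [x] to [b],
    and shorten this walk of at most [2 * (h - 1)] edges. It avoids the rest of
    [T]: an element of [T] on the chain from [x] to [a] lies below [a], and [T]
    is an antichain. *)
Lemma fan_path x a b : below x -> a \in T -> b \in T -> a != b ->
  exists q, [/\ path (@adj G) a (rcons q b), uniq q,
     {subset q <= fan x} & size q + 3 <= 2 * h].
Proof.
move=> bx aT bT neq; have /forall_inP bx' := bx.
have xT := below_notin bx.
have [pa la sa /allP aa] := chP (bx' a aT); have [pb lb sb /allP ab] := chP (bx' b bT).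
have [c1 E1] : exists c1, ch x a = rcons c1 a.
  case/lastP: (ch x a) la => [/= E|c z]; first by rewrite E aT in xT.
  by rewrite last_rcons => ->; exists c.
pose walk := rev (belast x (ch x a)) ++ ch x b.
have pw : path (@adj G) a walk.
  rewrite cat_path -{1}la rev_path; apply/andP; split.
    by apply: sub_path pa => u v; rewrite adj_sym.
  by rewrite E1 belast_rcons rev_cons last_rcons.
have lw : last a walk = b.
  by rewrite last_cat E1 belast_rcons rev_cons last_rcons.
have sw : size walk + 2 <= 2 * h by rewrite size_cat size_rev size_belast; lia.
have mw z : z \in walk -> z = a \/ z = b \/ z \in fan x.
  rewrite mem_cat mem_rev => zw.
  have zc : (z \in x :: ch x a) || (z \in x :: ch x b).
    case/orP: zw => [/mem_belast->//|zb].
    by rewrite !inE zb !orbT.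
  have [zT|zT] := boolP (z \in T); last first.
    right; right; rewrite inE zT inE; apply/exists_inP.
    by case/orP: zc => zc; [exists a | exists b].
  have nzx : z != x by apply: contraNneq xT => <-.
  move: zc; rewrite !inE (negPf nzx) /=.
  case/orP=> [/aa|/ab] /andP[_ zle]; [left|right; left]; exact: antiT.
have [p' [pp' lp' up' sp']] : exists p', [/\ path (@adj G) a p', last a p' = b,
    uniq (a :: p') & {subset p' <= walk}].
  by move: lw; case/shortenP: pw => p' ? ? ? ?; exists p'; split.
case/lastP: p' => [|q z] in pp' lp' up' sp' *.
  by rewrite /= in lp'; rewrite lp' eqxx in neq.
rewrite last_rcons in lp'; subst z; exists q; split=> //.
- by move: up'; rewrite /= rcons_uniq => /and3P[].
- move=> z zq; have zw : z \in walk by apply: sp'; rewrite mem_rcons inE zq orbT.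
  move: up'; rewrite /= rcons_uniq mem_rcons inE negb_or => /and3P[/andP[_ aq] bq _].
  by case: (mw z zw) => [E|[E|//]]; subst z; rewrite zq in aq bq.
- have := uniq_leq_size _ sp'; rewrite size_rcons => H.
  have {}H : size q < size walk by apply: H; case/andP: up'.
  by lia.
Qed.

(** Give each edge of the complete graph on [T] its own fan: more disjoint fans
    than edges would produce a forbidden subdivision. *)
Lemma fans_subdivision (D : {set G}) :
  {in D, forall x, below x} ->
  {in D &, forall x y, x != y -> [disjoint fan x & fan y]} ->
  #|D| < #|sd_edge (complete_graph t)|.
Proof.
move=> bD dD; rewrite ltnNge; apply/negP => leD; apply: no_sub.
pose a (i : 'I_t) := enum_val (cast_ord (esym cardT) i).
have aT i : a i \in T by exact: enum_valP.
have ainj : injective a by move=> i j /enum_val_inj/cast_ord_inj.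
pose x (p : sd_edge (complete_graph t)) := enum_val (widen_ord leD (enum_rank p)).
have xD p : x p \in D by exact: enum_valP.
have xinj : injective x.
  by move=> p p' /enum_val_inj/(congr1 val)/= /val_inj/enum_rank_inj.
have ex_q (p : sd_edge (complete_graph t)) : exists q,
    [/\ path (@adj G) (a (val p).1) (rcons q (a (val p).2)), uniq q,
     {subset q <= fan (x p)} & size q + 3 <= 2 * h].
  apply: fan_path; rewrite ?bD //.
  apply/negP => /eqP /ainj E; have /andP[/=] := valP p.
  by rewrite E eqxx.
have [q qP] := fin_all_exists ex_q.
apply: (@subdivision_of_paths (complete_graph t) G _ a q) => //.
- by move=> p; have [] := qP p.
- by move=> p; have [] := qP p.
- move=> p i; apply/negP; have [_ _ sub _] := qP p => /sub.
  by rewrite !inE aT.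
- move=> p p' z; have [_ _ sub _] := qP p; have [_ _ sub' _] := qP p'.
  move=> /sub zf /sub' zf'; apply: xinj; apply/eqP; apply/negPn/negP => neq.
  by have /pred0P/(_ z) := dD _ _ (xD p) (xD p') neq; rewrite /= zf zf'.
- by move=> p; have [_ _ _] := qP p; lia.
Qed.

Lemma card_sd_edge_complete : #|sd_edge (complete_graph t)| <= t * t.
Proof.
rewrite card_sig; apply: leq_trans (max_card _) _.
by rewrite card_prod card_ord.
Qed.

(** Take a maximal family of disjoint fans. It is small, and each further fan
    meets its union by maximality. *)
Lemma hitting_set : exists Z : {set G}, #|Z| <= t * t * (t * h) /\
  forall x, below x -> exists z,
    [/\ z \in Z, le x z & exists2 a, a \in T & le z a /\ z != a].
Proof.
pose ok (D : {set G}) := [forall x in D, below x] &&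
  [forall x in D, forall y in D, (x != y) ==> [disjoint fan x & fan y]].
have okP (D : {set G}) : reflect ({in D, forall x, below x} /\
    {in D &, forall x y, x != y -> [disjoint fan x & fan y]}) (ok D).
  apply: (iffP andP) => [] [H1 H2]; split.
  - exact/forall_inP.
  - by move=> x y xD yD; move/forall_inP: H2 => /(_ x xD)/forall_inP/(_ y yD)/implyP.
  - exact/forall_inP.
  - by apply/forall_inP => x xD; apply/forall_inP => y yD; apply/implyP; apply: H2.
have ok0 : ok set0 by apply/okP; split=> x; rewrite inE.
case: (arg_maxnP (fun D : {set G} => #|D|) ok0) => D /okP[bD dD] Dmax.
exists (\bigcup_(x in D) fan x); split.
  apply: leq_trans (card_bigcup_le _ _) _.
  apply: (@leq_trans (\sum_(x in D) t * h)).
    by apply: leq_sum => x xD; apply/card_fan/bD.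
  rewrite sum_nat_const leq_mul2r (leq_trans (ltnW (fans_subdivision bD dD))) ?orbT //.
  exact: card_sd_edge_complete.
move=> x bx; suff [z zx zZ] : exists2 z, z \in fan x & z \in \bigcup_(x in D) fan x.
  have [a aT [xz za nza]] := fan_le bx zx.
  by exists z; split=> //; exists a.
have [xD|xD] := boolP (x \in D).
  by exists x; [exact: mem_fan | apply/bigcupP; exists x => //; exact: mem_fan].
have [dis|] := boolP [disjoint fan x & \bigcup_(x in D) fan x]; last first.
  by move=> /pred0Pn[z /= /andP[]]; exists z.
have /Dmax : ok (x |: D); last by rewrite cardsU1 xD /=; lia.
have dis' y : y \in D -> [disjoint fan x & fan y].
  by move=> yD; apply: disjointWr dis; apply: bigcup_sup.
apply/okP; split=> [y|y z]; first by case/setU1P => [->|/bD].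
case/setU1P => [->|yD] /setU1P[->|zD]; rewrite ?eqxx //.
- by move=> _; apply: dis'.
- by move=> _; rewrite disjoint_sym; apply: dis'.
- exact: dD.
Qed.

End Hitting.

Hypothesis t_gt1 : 1 < t.
Variables (W : G -> {set G}) (c : nat).
Hypothesis card_W : forall v, #|W v| <= c.
Hypothesis reach_W : forall v u, reach rk (4 * h.-1) (rk u) v u -> u \in W v.

Definition antichain (T : {set G}) :=
  [forall a in T, forall b in T, le a b ==> (a == b)].

Lemma antichainP (T : {set G}) :
  reflect {in T &, forall a b, le a b -> a = b} (antichain T).
Proof.
apply: (iffP forall_inP) => [H a b /H/forall_inP H' /H'/implyP H'' ab|H a aT].
  exact/eqP/H''.
by apply/forall_inP => b bT; apply/implyP => /(H a b aT bT)->.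
Qed.

(** A system [Z] that lets any [x] below [T] move on to an element strictly
    below some member of [T]. The target is taken from a set that depends on
    [T] alone. *)
Definition refines (Z : {set G} -> {set G}) := forall (T : {set G}) x,
  #|T| = t -> antichain T -> (forall a, a \in T -> le x a) ->
  exists u, [/\ u \in Z T, lowest x u & exists2 a, a \in T & le u a /\ u != a].

(** The hitting set provides [z] strictly below some member of [T] with [x] below
    [z]; the element of smallest rank between [x] and [z] is weakly reachable
    from [z] as well as from [x]. *)
Lemma ex_refines : exists Z, refines Z /\ forall T, #|Z T| <= t * t * (t * h) * c.
Proof.
suff /fin_all_exists[Z ZP] : forall T : {set G}, exists ZT : {set G},
    (#|T| = t -> antichain T -> forall x, (forall a, a \in T -> le x a) ->
     exists u, [/\ u \in ZT, lowest x u & exists2 a, a \in T & le u a /\ u != a]) /\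
    #|ZT| <= t * t * (t * h) * c.
  exists Z; split=> [T x cT aT|T]; last by have [] := ZP T.
  by have [H _] := ZP T; apply: H.
move=> T; have [/andP[/eqP cT /antichainP aT]|nT] := boolP ((#|T| == t) && antichain T);
  last first.
  exists set0; split; last by rewrite cards0.
  by move=> cT aT; move: nT; rewrite cT eqxx aT.
have [Z0 [cZ ZP]] := hitting_set cT aT t_gt1.
exists (\bigcup_(z in Z0) W z); split=> [_ _ x bx|].
  have [|z [zZ xz [a aT' [za nza]]]] := ZP x; first exact/forall_inP.
  have [u [xu uz umin]] := ex_lowest xz.
  have /lowestP[lexu _] := xu.
  exists u; split=> //.
    apply/bigcupP; exists z => //; apply: reach_W.
    apply/reach_sym; apply: (@reach_le _ _ h.-1); first lia.
    apply: chain_reach => // z' uz' z'z; apply: umin => //; exact: le_trans uz'.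
  exists a => //; split; first exact: le_trans za.
  apply: contraNneq nza => ua; subst u; apply/eqP/le_anti.
  by rewrite za.
apply: leq_trans (card_bigcup_le _ _) _.
apply: (@leq_trans (\sum_(z in Z0) c)); first by apply: leq_sum.
by rewrite sum_nat_const leq_mul2r cZ orbT.
Qed.

Section Candidates.
Variable Z : {set G} -> {set G}.
Hypothesis Z_refines : refines Z.

Definition enlarge (A : {set G}) : {set G} :=
  A :|: \bigcup_(T in [set T : {set G} | (T \subset A) && (#|T| == t)]) Z T.

(** All elements that can appear among the first [n] members of a list below
    [w], whoever the owner of the list is. *)
Definition candidates n w := iter n enlarge (W w).

Lemma candidates_mono m n w : m <= n -> candidates m w \subset candidates n w.
Proof.
move=> /subnK<-; elim: (n - m) => //= k IH.
exact: subset_trans IH (subsetUl _ _).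
Qed.

Lemma card_enlarge (A : {set G}) b g m : 2 <= b -> #|A| <= b ^ g ->
  (forall T, #|Z T| <= b ^ m) -> #|enlarge A| <= b ^ (g * t.+1 + m + 1).
Proof.
move=> b2 Ag Zm; rewrite /enlarge (leq_trans (leq_card_setU _ _)) //.
apply: (@leq_trans (b ^ g + b ^ (g * t) * b ^ m)).
  apply: leq_add => //; apply: leq_trans (card_bigcup_le _ _) _.
  apply: (@leq_trans (\sum_(T in [set T : {set G} | (T \subset A) && (#|T| == t)]) b ^ m)).
    by apply: leq_sum.
  rewrite sum_nat_const leq_mul2r cards_draws (leq_trans (leq_bin_exp _ _)) ?orbT //.
  by rewrite expnM; apply: leq_expl.
have b0 : 0 < b by apply: leq_trans b2.
rewrite addn1 expnS -expnD; apply: (@leq_trans (2 * b ^ (g * t.+1 + m))).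
  rewrite mul2n -addnn leq_add // leq_pexp2l //; lia.
by rewrite leq_mul2r b2 orbT.
Qed.

Fixpoint candidates_exponent m n :=
  if n is n'.+1 then candidates_exponent m n' * t.+1 + m + 1 else 1.

Lemma card_candidates b m n w : 2 <= b -> c <= b -> (forall T, #|Z T| <= b ^ m) ->
  #|candidates n w| <= b ^ candidates_exponent m n.
Proof.
move=> b2 cb Zm; elim: n => [|n IH]; last exact: card_enlarge.
by rewrite expn1 (leq_trans (card_W w)).
Qed.

(** An element outweighs any [t] elements of smaller level, so replacing members
    of [T] by one element strictly below them increases the weight. *)
Definition weight (T : {set G}) := \sum_(a in T) t.+1 ^ level a.

Definition push e (T : {set G}) := e |: [set a in T | ~~ le e a].

Lemma push_antichain e (T : {set G}) : antichain T -> (forall a, a \in T -> ~~ le a e) ->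
  antichain (push e T).
Proof.
move=> /antichainP aT up; apply/antichainP => a b.
rewrite !inE => /orP[/eqP->|/andP[a1 a2]] /orP[/eqP->|/andP[b1 b2]] //.
- by rewrite (negPf b2).
- by rewrite (negPf (up a a1)).
- exact: aT.
Qed.

Lemma weight_push e (T : {set G}) : #|T| <= t -> (forall a, a \in T -> ~~ le a e) ->
  weight T < weight (push e T).
Proof.
move=> cT up; rewrite {2}/weight /push big_setU1 /=; last first.
  by rewrite inE le_refl andbF.
rewrite /weight (bigID (fun a => le e a)) /= -addSn leq_add //; last first.
  by apply: eq_leq; apply: eq_bigl => a; rewrite inE.
rewrite -(@ltn_pmul2r t.+1) // big_distrl /=.
apply: (@leq_ltn_trans (\sum_(a in T) t.+1 ^ level e)).
  rewrite [leqRHS](bigID (fun a => le e a)) /= (leq_trans _ (leq_addr _ _)) //.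
  apply: leq_sum => a /andP[aT ea]; rewrite -expnSr leq_pexp2l // level_lt //.
  by apply: contraNneq (up a aT) => ->.
by rewrite sum_nat_const mulnC ltn_pmul2l ?expn_gt0.
Qed.

Lemma weight_le (T : {set G}) : #|T| <= t -> weight T <= t * t.+1 ^ h.
Proof.
move=> cT; apply: (@leq_trans (\sum_(a in T) t.+1 ^ h)).
  by apply: leq_sum => a _; rewrite leq_pexp2l // level_le.
by rewrite sum_nat_const leq_mul2r cT orbT.
Qed.

(** The chain from [w] down to [x] followed by the chain from [x] up to [u] is a
    walk on which [u] has the smallest rank. *)
Lemma lowest_near x u w : lowest x u -> lowest x w -> rk u <= rk w -> u \in W w.
Proof.
move=> /lowestP[xu umin] /lowestP[xw wmin] uw; apply: reach_W.
apply: (@reach_le _ _ (h.-1 + h.-1)); first lia.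
apply: (@reach_trans _ _ _ _ _ _ x); last exact: chain_reach.
apply/reach_sym/chain_reach => // z xz zw; apply: leq_trans uw _; exact: wmin.
Qed.

(** While [T] has fewer than [t] members, the next element is the one of
    smallest rank outside the up-set of [T]: if [w] is outside too, this
    element has rank at most that of [w], hence is weakly reachable from [w].
    When [T] has [t] members, the next element comes from [Z T]. Both choices are
    confined to a small set as soon as [w] is known, although [x] is not. *)
Lemma next_element x (T : {set G}) : #|T| <= t -> antichain T -> x \notin T ->
  {in T, forall a, lowest x a} ->
  exists e, [/\ lowest x e, forall a, a \in T -> ~~ le a e, #|push e T| <= t
   & forall n w, lowest x w -> T \subset candidates n w ->
      (forall a, a \in T -> ~~ le a w) -> e \in candidates n.+1 w].
Proof.
move=> cT aT xT uT; have xle a : a \in T -> le x a by move/uT => /lowestP[].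
have [tT|] := eqVneq #|T| t; last first.
  rewrite neq_ltn => /orP[cT'|]; last by rewrite ltnNge cT.
  pose free := [pred e | lowest x e && [forall a in T, ~~ le a e]].
  have Px : free x.
    rewrite /= lowest_refl; apply/forall_inP => a aT'; apply: contra xT => ax.
    by rewrite (@le_anti x a) // xle.
  case: (arg_minnP rk Px) => e /andP[xe /forall_inP up] emin; exists e; split=> //.
    apply: leq_trans (leq_card_setU _ _) _; rewrite cards1 add1n.
    apply: leq_ltn_trans cT'; apply/subset_leq_card/subsetP => a.
    by rewrite inE => /andP[].
  move=> n w xw _ upw; apply: (subsetP (candidates_mono w (leq0n n.+1))).
  apply: (lowest_near xe xw); apply: emin; rewrite /= xw.
  exact/forall_inP.
have [e [eZ xe [a aT' [ea nea]]]] := Z_refines tT aT xle.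
have up a' : a' \in T -> ~~ le a' e.
  move=> a'T; apply: contra nea => a'e; apply/eqP.
  have /antichainP/(_ a' a a'T aT' (le_trans a'e ea)) E := aT.
  by apply: le_anti; rewrite ea -E a'e.
exists e; split=> //.
  apply: leq_trans (leq_card_setU _ _) _; rewrite cards1 add1n -tT.
  apply: proper_card; apply/properP; split.
    by apply/subsetP => ?; rewrite inE => /andP[].
  by exists a; rewrite // inE ea andbF.
move=> n w xw Tw _; rewrite inE; apply/orP; right; apply/bigcupP; exists T => //.
by rewrite inE Tw tT eqxx.
Qed.

(** Repeat the step above, keeping the minimal elements in [T]. The weight
    strictly increases, so the process stops, and it can only stop at [x]
    itself, which is below every [w]. At the first time some listed element is
    below [w], all earlier choices were confined. *)
Lemma ex_list x n (T : {set G}) : #|T| <= t -> antichain T -> {in T, forall a, lowest x a} ->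
  t * t.+1 ^ h < weight T + n ->
  exists s, [/\ size s <= n, {in s, forall a, lowest x a} &
    forall w j, lowest x w -> T \subset candidates j w ->
      (exists2 a, a \in T & le a w) \/
      exists2 a, a \in s & le a w /\ a \in candidates (j + n) w].
Proof.
elim: n T => [|n IH] T cT aT uT wT.
  by rewrite addn0 ltnNge weight_le in wT.
have [xT|xT] := boolP (x \in T).
  exists [::]; split=> // w j /lowestP[xw _] _; left; by exists x.
have [e [xe up cP near]] := next_element cT aT xT uT.
have uP : {in push e T, forall a, lowest x a}.
  by move=> a; rewrite !inE => /orP[/eqP->|/andP[/uT]].
have [|s [ss us sP]] := IH (push e T) cP (push_antichain aT up) uP.
  by have := weight_push cT up; lia.
exists (e :: s); split=> // [a|w j xw Tw].
  by rewrite inE => /orP[/eqP->|/us].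
have [/exists_inP|/exists_inPn nle] := boolP [exists a in T, le a w].
  by left.
right; have ew := near j w xw Tw nle.
have Tw' : push e T \subset candidates j.+1 w.
  apply/subsetP => a /setU1P[->//|/setIdP[/(subsetP Tw) aw _]].
  exact: (subsetP (candidates_mono w (leqnSn j))).
case: (sP w j.+1 xw Tw') => [[a]|[a as_ [aw ac]]].
  rewrite !inE => /orP[/eqP->|/andP[/nle/negP//]] ew'; exists e; rewrite ?inE ?eqxx //.
  split=> //; apply: (subsetP (candidates_mono w _)) ew; lia.
by exists a; rewrite ?inE ?as_ ?orbT // addnS -addSn.
Qed.

Definition list_size := t * t.+1 ^ h + 1.

(** Lists are padded with [x] so that all have the same length. *)
Lemma ex_cofinal_list : exists e : G -> 'I_list_size -> G,
  (forall x p, lowest x (e x p)) /\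
  forall x w, lowest x w -> exists p, le (e x p) w /\ e x p \in candidates list_size w.
Proof.
suff /fin_all_exists[e eP] : forall x, exists e : 'I_list_size -> G,
    (forall p, lowest x (e p)) /\
    forall w, lowest x w -> exists p, le (e p) w /\ e p \in candidates list_size w.
  by exists e; split=> x; have [] := eP x.
move=> x; have [||||s [ss us sP]] := @ex_list x list_size set0.
- by rewrite cards0.
- by apply/antichainP => a; rewrite inE.
- by move=> a; rewrite inE.
- by rewrite /weight big_set0 /list_size; lia.
exists (nth x s); split=> [p|w xw].
  have [ps|ps] := ltnP p (size s); first by apply/us/mem_nth.
  by rewrite nth_default // lowest_refl.
case: (sP w 0 xw (sub0set _)) => [[a]|[a as_ [aw ac]]]; first by rewrite inE.
have ps : index a s < list_size by apply: leq_trans ss; rewrite index_mem.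
by exists (Ordinal ps); rewrite /= nth_index.
Qed.

End Candidates.
(** However many [w] satisfy [lowest x w], the list of [x] has bounded length
    and a member below each of them, which [w] determines up to polynomially many
    choices. *)
Lemma ex_small_cofinal_lists b m : 2 <= b -> c <= b -> t * t * (t * h) * c <= b ^ m ->
  exists (A : G -> {set G}) (e : G -> 'I_list_size -> G),
  [/\ forall w, #|A w| <= b ^ candidates_exponent m list_size,
      forall x p, lowest x (e x p)
    & forall x w, lowest x w -> exists p, le (e x p) w /\ e x p \in A w].
Proof.
move=> b2 cb mP; have [Z [Zref Zcard]] := ex_refines.
have [e [eU eP]] := ex_cofinal_list Zref.
exists (candidates Z list_size), e; split=> // w; apply: card_candidates => // T.
exact: leq_trans (Zcard T) mP.
Qed.

End Lists.

(** * Colouring by conflicts *)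

(** In-degrees and out-degrees have the same sum, so every set of vertices has a
    member with at most [2 * D] neighbours in it; colour greedily. *)
Lemma outdegree_coloring (V : finType) (r : rel V) D :
  (forall x, #|[set y | r x y]| <= D) ->
  exists psi : V -> 'I_D.*2.+1, forall x y, r x y -> x != y -> psi x != psi y.
Proof.
move=> degD.
suff /(_ #|V| setT) : forall n (S : {set V}), #|S| <= n -> exists psi : V -> 'I_D.*2.+1,
    {in S &, forall x y, r x y -> x != y -> psi x != psi y}.
  by rewrite cardsT => /(_ (leqnn _))[psi H]; exists psi => x y; apply: H; rewrite inE.
elim=> [|n IH] S cS.
  exists (fun _ => ord0) => x y xS.
  by move: cS xS; rewrite leqn0 cards_eq0 => /eqP->; rewrite inE.
have [->|[x0 x0S]] := set_0Vmem S.
  by exists (fun _ => ord0) => x y; rewrite inE.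
have [x xS indeg] : exists2 x, x \in S & #|[set y in S | r y x]| <= D.
  apply/exists_inP; rewrite -[X in is_true X]negbK negb_exists_in; apply/negP.
  move=> /forall_inP H.
  have : \sum_(x in S) D.+1 <= \sum_(x in S) #|[set y in S | r y x]|.
    by apply: leq_sum => x /H; rewrite ltnNge.
  have -> : \sum_(x in S) #|[set y in S | r y x]| =
            \sum_(y in S) #|[set x in S | r y x]|.
    under eq_bigr do rewrite -sum1dep_card big_mkcondr /=.
    under [RHS]eq_bigr do rewrite -sum1dep_card big_mkcondr /=.
    exact: exchange_big.
  rewrite leqNgt => /negP; apply; apply: (@leq_ltn_trans (\sum_(x in S) D)).
    apply: leq_sum => y _; apply: leq_trans (degD y).
    by apply/subset_leq_card/subsetP => z; rewrite !inE => /andP[].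
  by rewrite !sum_nat_const ltn_pmul2l //; apply/card_gt0P; exists x0.
have [|psi psiP] := IH (S :\ x).
  by move: cS; rewrite (cardsD1 x) xS.
pose nb := psi @: ([set y | r x y] :|: [set y in S | r y x]).
have [col colP] : exists col, col \notin nb.
  have : 0 < #|~: nb|.
    have : #|nb| <= D.*2.
      apply: leq_trans (leq_imset_card _ _) _; rewrite -addnn.
      by apply: leq_trans (leq_card_setU _ _) _; apply: leq_add.
    by have := cardsC nb; rewrite card_ord; lia.
  by case/card_gt0P => col; rewrite inE; exists col.
exists (fun y => if y == x then col else psi y) => y z yS zS.
have [->|yx] := eqVneq y x; have [->|zx] := eqVneq z x; rewrite ?eqxx //.
- move=> rxz _; apply: contraNneq colP => ->; apply: imset_f.
  by rewrite !inE rxz.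
- move=> ryx _; apply: contraNneq colP => <-; apply: imset_f.
  by rewrite !inE yS ryx orbT.
- by move=> ryz yz; apply: psiP => //; rewrite !inE ?yx ?zx.
Qed.

(** Two elements conflict when one of them is a candidate for some vertex that
    is weakly reachable from the other. *)
Lemma conflict_coloring (V : finType) (W A : V -> {set V}) c a :
  (forall v, #|W v| <= c) -> (forall z, #|A z| <= a) ->
  exists psi : V -> 'I_(c * a).*2.+1,
    forall v z u, z \in W v -> u \in A z -> v != u -> psi v != psi u.
Proof.
move=> cW cA; pose r v u := [exists z in W v, u \in A z].
have [v|psi psiP] := @outdegree_coloring V r (c * a).
  have -> : [set u | r v u] = \bigcup_(z in W v) A z.
    apply/setP => u; rewrite inE; apply/exists_inP/bigcupP => [] [z zW uA];
    by exists z.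
  apply: leq_trans (card_bigcup_le _ _) _.
  apply: (@leq_trans (\sum_(z in W v) a)); first exact: leq_sum.
  by rewrite sum_nat_const leq_mul2r cW orbT.
exists psi => v z u zW uA; apply: psiP.
by apply/exists_inP; exists z.
Qed.

(** * Signatures exclude alternating cycles *)

Section Signature.
Variables (G : sgraph) (rk : G -> nat) (le : rel G) (H : nat).
Hypothesis rk_inj : injective rk.
Hypothesis le_refl : reflexive le.
Hypothesis le_trans : transitive le.
Hypothesis chain_reach : forall m x y, le x y ->
  (forall z, le x z -> le z y -> m <= rk z) -> reach rk H m x y.
Variable W : G -> {set G}.
Hypothesis reach_W : forall v u, reach rk (4 * H) (rk u) v u -> u \in W v.

(* In this section [A w] and [B w] hold the candidates below and above [w], and
    [e x], [f y] are the lists of [x] going up and of [y] going down. *)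
Let U := lowest rk le.
Let V := lowest rk (fun a b => le b a).

Variables (K N : nat) (A B : G -> {set G}) (e f : G -> 'I_K -> G) (psiE psiF : G -> 'I_N).
Hypothesis e_U : forall x p, U x (e x p).
Hypothesis f_V : forall y q, V y (f y q).
Hypothesis e_cofinal : forall x w, U x w -> exists p, le (e x p) w /\ e x p \in A w.
Hypothesis f_cofinal : forall y w, V y w -> exists q, le w (f y q) /\ f y q \in B w.
Hypothesis psiE_proper : forall a' z a, z \in W a' -> a \in A z -> a' != a -> psiE a' != psiE a.
Hypothesis psiF_proper : forall b' z b, z \in W b' -> b \in B z -> b' != b -> psiF b' != psiF b.

Let fourH : 4 * H = H + (H + (H + H)).
Proof. by rewrite !mulSn mul0n addn0. Qed.

Definition low a b := [arg min_(z < a | le a z && le z b) rk z].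

Lemma lowP a b : le a b ->
  [/\ le a (low a b), le (low a b) b & forall z, le a z -> le z b -> rk (low a b) <= rk z].
Proof.
move=> ab; pose I := [pred z | le a z && le z b].
have Ia : I a by rewrite /= le_refl.
rewrite /low; case: (arg_minnP rk Ia) => z /andP[az zb] zmin; split=> // z' az' zb'.
by apply: zmin; rewrite /= az'.
Qed.

Lemma low_eq x y a b : le x a -> le b y -> le a (low x y) -> le (low x y) b ->
  low a b = low x y.
Proof.
move=> xa by_ aw wb; have ab := le_trans aw wb.
have [_ _ xymin] := lowP (le_trans xa (le_trans ab by_)).
have [al lb abmin] := lowP ab.
apply: rk_inj; apply/eqP; rewrite eqn_leq abmin // xymin //.
  exact: le_trans al.
exact: le_trans by_.
Qed.

(** The pairs of listed elements through which a comparability [x <= y] is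
    detected: for [w := low x y] some listed [a] and [b] enclose [w] and are
    candidates for it. *)
Definition relevant a b := [&& le a b, a \in A (low a b) & b \in B (low a b)].

(** If [low a b] has the smaller rank, walking from [b'] down to [a] and up to
    [low a b] shows that [low a b] is weakly reachable from [b']. As [b] is a
    candidate for [low a b], the elements [b] and [b'] conflict unless equal. *)
Lemma relevant_uniqF a b b' :
  relevant a b -> relevant a b' -> psiF b = psiF b' -> b = b'.
Proof.
wlog leq : b b' / rk (low a b) <= rk (low a b').
  move=> WL r r' E; have [l|l] := leqP (rk (low a b)) (rk (low a b')); first exact: WL.
  by apply/esym; apply: WL => //; apply: ltnW.
move=> /and3P[ab _ bB] /and3P[ab' _ _] E; apply/eqP/negPn/negP => neq.
have [az zb zmin] := lowP ab; have [_ _ zmin'] := lowP ab'.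
suff : low a b \in W b'.
  move=> /psiF_proper/(_ bB); rewrite eq_sym neq E eqxx => /(_ isT) //.
apply/reach_W/(@reach_le _ _ (H + H)); first lia.
apply: (@reach_trans _ _ _ _ _ _ a).
  by apply/reach_sym/chain_reach => // z az' zb'; apply: leq_trans leq _; apply: zmin'.
by apply: chain_reach => // z az' zl; apply: zmin => //; apply: le_trans zb.
Qed.

(** The mirror image of [relevant_uniqF]. *)
Lemma relevant_uniqE a a' b :
  relevant a b -> relevant a' b -> psiE a = psiE a' -> a = a'.
Proof.
wlog leq : a a' / rk (low a b) <= rk (low a' b).
  move=> WL r r' E; have [l|l] := leqP (rk (low a b)) (rk (low a' b)); first exact: WL.
  by apply/esym; apply: WL => //; apply: ltnW.
move=> /and3P[ab aA _] /and3P[ab' _ _] E; apply/eqP/negPn/negP => neq.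
have [az zb zmin] := lowP ab; have [_ _ zmin'] := lowP ab'.
suff : low a b \in W a'.
  move=> /psiE_proper/(_ aA); rewrite eq_sym neq E eqxx => /(_ isT) //.
apply/reach_W/(@reach_le _ _ (H + H)); first lia.
apply: (@reach_trans _ _ _ _ _ _ b).
  by apply/chain_reach => // z az' zb'; apply: leq_trans leq _; apply: zmin'.
by apply/reach_sym/chain_reach => // z az' zl; apply: zmin => //; apply: le_trans az'.
Qed.

(** Suppose that [low a b0] has the smaller rank of the two. Then the walk from
    [b] to [y], [x], [a] and [low a b0], made of four chains, stays above it in
    rank, so [b] and [b0] conflict unless equal, and the colours exclude a
    conflict. This walk is the reason for the radius [4 * h - 4]. *)
Lemma relevant_propagate x y a b a' b0 : le x y -> U x a -> V y b ->
  relevant a b0 -> relevant a' b -> psiE a' = psiE a -> psiF b0 = psiF b ->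
  (rk (low a b0) <= rk (low x y)) || (rk (low a' b) <= rk (low x y)) ->
  low a b0 = low a' b.
Proof.
move=> xy /lowestP[xa amin] /lowestP[yb bmin] r r' Ea Eb small.
have /and3P[ab0 aA b0B] := r; have /and3P[a'b a'A bB] := r'.
have [_ _ xymin] := lowP xy.
have [az zb0 zmin] := lowP ab0; have [a'z' z'b z'min] := lowP a'b.
have [leq|lt] := leqP (rk (low a b0)) (rk (low a' b)).
  have zm : rk (low a b0) <= rk (low x y).
    by case/orP: small => // ; apply: leq_trans.
  suff zW : low a b0 \in W b.
    have E : b = b0.
      by apply/eqP/negPn/negP => /(psiF_proper zW b0B); rewrite Eb eqxx.
    by subst b0; rewrite (relevant_uniqE r r').
  apply: reach_W; rewrite fourH.
  apply: (@reach_trans _ _ _ _ _ _ y).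
    apply: chain_reach => // z bz zy; apply: leq_trans leq _.
    by apply: leq_trans (bmin z zy bz); apply: z'min.
  apply: (@reach_trans _ _ _ _ _ _ x).
    by apply/reach_sym/chain_reach => // z xz zy; apply: leq_trans zm _; apply: xymin.
  apply: (@reach_trans _ _ _ _ _ _ a).
    apply: chain_reach => // z xz za; apply: leq_trans (amin z xz za).
    exact: zmin.
  by apply: chain_reach => // z a_z zl; apply: zmin => //; apply: le_trans zb0.
have zm : rk (low a' b) <= rk (low x y).
  by case/orP: small => //; apply: leq_trans; apply: ltnW.
suff zW : low a' b \in W a.
  have E : a = a'.
    by apply/eqP/negPn/negP => /(psiE_proper zW a'A); rewrite Ea eqxx.
  by subst a'; rewrite (relevant_uniqF r r').
apply: reach_W; rewrite fourH.
apply: (@reach_trans _ _ _ _ _ _ x).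
  apply/reach_sym/chain_reach => // z xz za; apply: leq_trans (ltnW lt) _.
  by apply: leq_trans (amin z xz za); apply: zmin.
apply: (@reach_trans _ _ _ _ _ _ y).
  by apply: chain_reach => // z xz zy; apply: leq_trans zm _; apply: xymin.
apply: (@reach_trans _ _ _ _ _ _ b).
  apply/reach_sym/chain_reach => // z bz zy; apply: leq_trans (bmin z zy bz).
  exact: z'min.
by apply/reach_sym/chain_reach => // z lz zb'; apply: z'min => //; apply: le_trans lz.
Qed.

(** By [relevant_uniqF] the colour [beta] designates at most one partner of [a].
    Ranks are shifted by one, so that 0 means that no partner exists. *)
Definition left_rank a (beta : 'I_N) :=
  if [pick b | relevant a b && (psiF b == beta)] is Some b then (rk (low a b)).+1 else 0.

Definition right_rank b (alpha : 'I_N) :=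
  if [pick a | relevant a b && (psiE a == alpha)] is Some a then (rk (low a b)).+1 else 0.

Lemma left_rankP a beta : 0 < left_rank a beta ->
  exists b, [/\ relevant a b, psiF b = beta & left_rank a beta = (rk (low a b)).+1].
Proof. by rewrite /left_rank; case: pickP => // b /andP[r /eqP E] _; exists b. Qed.

Lemma right_rankP b alpha : 0 < right_rank b alpha ->
  exists a, [/\ relevant a b, psiE a = alpha & right_rank b alpha = (rk (low a b)).+1].
Proof. by rewrite /right_rank; case: pickP => // a /andP[r /eqP E] _; exists a. Qed.

Lemma left_rank_relevant a b : relevant a b -> left_rank a (psiF b) = (rk (low a b)).+1.
Proof.
rewrite /left_rank; case: pickP => [b' /andP[r' /eqP E] r|/(_ b)].
  by rewrite (relevant_uniqF r' r).
by move=> E r; rewrite r eqxx in E.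
Qed.

Lemma right_rank_relevant a b : relevant a b -> right_rank b (psiE a) = (rk (low a b)).+1.
Proof.
rewrite /right_rank; case: pickP => [a' /andP[r' /eqP E] r|/(_ a)].
  by rewrite (relevant_uniqE r' r).
by move=> E r; rewrite r eqxx in E.
Qed.

(** Ranks are unbounded, so only their comparisons are recorded: the number of
    signatures depends on the length [K] of the lists and the number [N] of
    colours alone. *)
Definition signature (xy : G * G) :=
  ([ffun i => psiE (e xy.1 i)], [ffun j => psiF (f xy.2 j)],
   [ffun ij : 'I_K * 'I_K =>
      let u := left_rank (e xy.1 ij.1) (psiF (f xy.2 ij.2)) in
      let v := right_rank (f xy.2 ij.2) (psiE (e xy.1 ij.1)) in
      (0 < u, 0 < v, u < v)]).

(** Take a comparability [x <= y] between two pairs of [C] for which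
    [w := low x y] has least rank, and the positions [i], [j] of listed elements
    detecting it. The numbers [u] and [v] read at these positions are then
    positive on all of [C]. They are never equal on a pair, which would otherwise
    be comparable, so [u < v] everywhere or [v < u] everywhere. As [u p = v q]
    whenever [p.1 <= q.2] and one of the two is small, following successors,
    respectively predecessors, from [w] would decrease the rank forever. *)
Lemma equal_signature_no_cycle (C : {set G * G}) :
  (forall p, p \in C -> ~~ le p.1 p.2) ->
  {in C &, forall p q, signature p = signature q} ->
  (forall p, p \in C -> exists2 q, q \in C & le p.1 q.2) ->
  (forall q, q \in C -> exists2 p, p \in C & le p.1 q.2) -> C = set0.
Proof.
move=> Cinc Csig Csucc Cpred; apply/eqP/set0Pn => -[p1 p1C].
pose edge := [pred pq : (G * G) * (G * G) | [&& pq.1 \in C, pq.2 \in C & le pq.1.1 pq.2.2]].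
have [q1 q1C pq1] := Csucc p1 p1C.
have edge1 : edge (p1, q1) by rewrite /= p1C q1C.
case: (arg_minnP (fun pq : (G * G) * (G * G) => rk (low pq.1.1 pq.2.2)) edge1).
move=> [p0 q0] /and3P[/= p0C q0C xy] emin {p1 q1 p1C q1C pq1 edge1}.
set x := p0.1 in xy emin; set y := q0.2 in xy emin.
pose w := low x y; have [xw wy wmin] := lowP xy.
have [|i [aw aA]] := @e_cofinal x w.
  by apply/lowestP; split=> // z xz zw; apply: wmin => //; apply: le_trans wy.
have [|j [wb bB]] := @f_cofinal y w.
  by apply/lowestP; split=> // z zy wz; apply: wmin => //; apply: le_trans wz.
have /lowestP[xa _] := e_U x i; have /lowestP[by_ _] := f_V y j.
have lowab : low (e x i) (f y j) = w by apply: low_eq.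
have rab : relevant (e x i) (f y j) by rewrite /relevant lowab aA bB (le_trans aw wb).
pose alpha := psiE (e x i); pose beta := psiF (f y j).
have Ealpha p : p \in C -> psiE (e p.1 i) = alpha.
  move=> pC; have [/ffunP/(_ i) + _ _] := Csig p p0 pC p0C.
  by rewrite !ffunE.
have Ebeta p : p \in C -> psiF (f p.2 j) = beta.
  move=> pC; have [_ /ffunP/(_ j) + _] := Csig p q0 pC q0C.
  by rewrite !ffunE.
pose u (p : G * G) := left_rank (e p.1 i) beta.
pose v (p : G * G) := right_rank (f p.2 j) alpha.
have sgn p q : p \in C -> q \in C ->
    [/\ (0 < u p) = (0 < u q), (0 < v p) = (0 < v q) & (u p < v p) = (u q < v q)].
  move=> pC qC; have [_ _ /ffunP/(_ (i, j))] := Csig p q pC qC.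
  by rewrite !ffunE /= !Ealpha // !Ebeta // => -[].
have u0 : u p0 = (rk w).+1 by rewrite /u left_rank_relevant ?lowab.
have v0 : v q0 = (rk w).+1 by rewrite /v right_rank_relevant ?lowab.
have upos p : p \in C -> 0 < u p by move=> pC; have [-> _ _] := sgn p p0 pC p0C; rewrite u0.
have vpos p : p \in C -> 0 < v p by move=> pC; have [_ -> _] := sgn p q0 pC q0C; rewrite v0.
have step p q : p \in C -> q \in C -> le p.1 q.2 ->
    (u p <= (rk w).+1) || (v q <= (rk w).+1) -> u p = v q.
  move=> pC qC pq; have := emin (p, q); rewrite /= pC qC pq => /(_ isT) wle.
  rewrite /u /v; have [b0 [r0 Eb0 ->]] := left_rankP (upos p pC).
  have [a' [r' Ea' ->]] := right_rankP (vpos q qC).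
  rewrite !ltnS => small; congr (rk _).+1.
  apply: (relevant_propagate pq (e_U _ _) (f_V _ _) r0 r').
  - by rewrite Ea' Ealpha.
  - by rewrite Eb0 Ebeta.
  - by case/orP: small => /leq_trans/(_ wle) ->; rewrite ?orbT.
have neq p : p \in C -> u p != v p.
  move=> pC; apply: contra (Cinc p pC) => /eqP.
  rewrite /u /v; have [b0 [r0 Eb0 ->]] := left_rankP (upos p pC).
  have [a' [r' Ea' ->]] := right_rankP (vpos p pC).
  move=> [/rk_inj E]; have /and3P[ab _ _] := r0; have /and3P[ab' _ _] := r'.
  have [az _ _] := lowP ab; have [_ zb _] := lowP ab'.
  have /lowestP[xa' _] := e_U p.1 i; have /lowestP[yb _] := f_V p.2 j.
  by apply: le_trans xa' (le_trans az _); rewrite E (le_trans zb yb).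
have [sign|sign] := boolP (u p0 < v p0).
  case: (arg_minnP v q0C) => p pC pmin; have [q qC pq] := Csucc p pC.
  have uv : u p < v p by have [_ _ ->] := sgn p p0 pC p0C.
  have uw : u p <= (rk w).+1 by rewrite -v0 (leq_trans (ltnW uv)) // pmin.
  by have := pmin q qC; rewrite -(step p q) ?uw // leqNgt uv.
case: (arg_minnP u p0C) => p pC pmin; have [q qC qp] := Cpred p pC.
have vu : v p < u p.
  have [_ _ E] := sgn p p0 pC p0C; rewrite -E in sign.
  by rewrite ltn_neqAle eq_sym neq // leqNgt.
have vw : v p <= (rk w).+1 by rewrite -u0 (leq_trans (ltnW vu)) // pmin.
by have := pmin q qC; rewrite (step q p) ?vw ?orbT // leqNgt vu.
Qed.

End Signature.

(** * Reversible sets and dimension *)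

Section LinearExtension.
Context {d : Order.disp_t} (P : finPOrderType d).

(** An alternating cycle is encoded as a set [C] in which every pair has a
    successor and a predecessor. If the order extended by the reversed pairs of
    [I] has a cycle, the pairs of [I] whose reversal lies on a cycle form such a
    set; otherwise that relation extends to a linear order. *)
Lemma reversible_of_no_cycle (I : {set P * P}) :
  (forall p, p \in I -> ~~ (p.1 <= p.2)%O) ->
  (forall C : {set P * P}, C \subset I ->
     (forall p, p \in C -> exists2 q, q \in C & (p.1 <= q.2)%O) ->
     (forall q, q \in C -> exists2 p, p \in C & (p.1 <= q.2)%O) -> C = set0) ->
  reversible I.
Proof.
move=> Inle noC.
pose S : rel P := fun a b => (a <= b)%O || ((b, a) \in I).
have Sle a b : (a <= b)%O -> connect S a b by move=> ab; rewrite connect1 // /S ab.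
have SI p : p \in I -> connect S p.2 p.1.
  by case: p => x y pI; rewrite connect1 // /S pI orbT.
(* Cut a path at its first reversed pair: everything before it is a comparability. *)
have first_rev a b : connect S a b -> (a <= b)%O \/
    exists2 q, q \in I & (a <= q.2)%O /\ connect S q.1 b.
  case/connectP => s; elim: s a => [|z s IH] a /=; first by move=> _ ->; left.
  case/andP => /orP[az|zaI] sp lb; last first.
    right; exists (z, a) => //; split=> //=.
    by apply/connectP; exists s.
  case: (IH z sp lb) => [zb|[q qI [zq qb]]];
    first by left; apply: Order.POrderTheory.le_trans zb.
  by right; exists q => //; split=> //; apply: Order.POrderTheory.le_trans zq.
(* The same at the last reversed pair. *)
have last_rev a b : connect S a b -> (a <= b)%O \/
    exists2 q, q \in I & connect S a q.2 /\ (q.1 <= b)%O.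
  case/connectP => s; elim/last_ind: s b => [|s z IH] b /=; first by move=> _ ->; left.
  rewrite rcons_path last_rcons => /andP[sp Sz] ->.
  case/orP: Sz => [az|zaI]; last first.
    right; exists (z, last a s) => //; split=> //=.
    by apply/connectP; exists s.
  case: (IH _ sp erefl) => [zb|[q qI [zq qb]]];
    first by left; apply: Order.POrderTheory.le_trans az.
  by right; exists q => //; split=> //; apply: Order.POrderTheory.le_trans az.
pose C := [set p in I | connect S p.1 p.2].
have C0 : C = set0.
  apply: noC => [|p|p]; first by apply/subsetP => p; rewrite inE => /andP[].
    rewrite inE => /andP[pI cp]; have := Inle p pI.
    case: (first_rev _ _ cp) => [->//|[q qI [pq qp]]] _; exists q => //.
    rewrite inE qI (connect_trans qp) // (connect_trans (SI p pI)) //; exact: Sle.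
  rewrite inE => /andP[pI cp]; have := Inle p pI.
  case: (last_rev _ _ cp) => [->//|[q qI [pq qp]]] _; exists q => //.
  rewrite inE qI (connect_trans (Sle _ _ qp)) // (connect_trans (SI p pI)) //.
have S_le a b : connect S a b -> connect S b a -> (a <= b)%O.
  move=> ab ba; case: (first_rev _ _ ab) => // -[q qI [aq qb]].
  have : q \in C; last by rewrite C0 inE.
  by rewrite inE qI (connect_trans qb) // (connect_trans ba) // Sle.
pose k b := #|[set a | connect S a b]|.
have kP a b : connect S a b -> (a, b) \in key_order k.
  move=> ab; have [->|neq] := eqVneq a b; first by rewrite inE /= eqxx.
  have : k a < k b; last by rewrite inE /=; case: ltngtP.
  apply/proper_card/properP; split.
    by apply/subsetP => z; rewrite !inE => /connect_trans; apply.
  exists b; rewrite !inE ?connect0 //; apply: contra neq => ba.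
  by apply/eqP/Order.POrderTheory.le_anti; rewrite !S_le.
apply/existsP; exists (key_order k); apply/andP; split.
  rewrite /linear_extension key_order_linear; apply/forallP => a.
  by apply/forallP => b; apply/implyP => /Sle/kP.
apply/forall_inP => p pI; rewrite kP ?SI // andbT.
by apply: contraNneq (Inle p pI) => ->.
Qed.

Lemma poset_dim_le_signature (Sig : finType) (sig : P * P -> Sig) :
  0 < #|Sig| ->
  (forall I : {set P * P}, I \subset Inc P -> {in I &, forall p q, sig p = sig q} ->
    reversible I) ->
  poset_dim P <= #|Sig|.
Proof.
move=> Sig0 revI; rewrite /poset_dim; case: ifP => // _.
case: ex_minnP => m _ /(_ #|preim_partition sig (Inc P)|) mmin.
apply: leq_trans (mmin _) _; first (apply/existsP; exists (preim_partition sig (Inc P))).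
  rewrite preim_partitionP eqxx andbT /=.
  apply/forall_inP => _ /imsetP[p pI ->]; apply: revI.
    by apply/subsetP => q; rewrite inE => /andP[].
  by move=> q q'; rewrite !inE => /andP[_ /eqP <-] /andP[_ /eqP <-].
have -> : preim_partition sig (Inc P) =
    (fun s => [set q in Inc P | s == sig q]) @: (sig @: Inc P) by rewrite -imset_comp.
exact: leq_trans (leq_imset_card _ _) (max_card _).
Qed.

End LinearExtension.

(** * Ranks and chains of covers *)

Lemma linear_order_rank (T : finType) (L : {set T * T}) : linear_order L ->
  exists2 rk : T -> nat, injective rk & forall u w, rk u <= rk w -> (u, w) \in L.
Proof.
case/and3P => /forallP tot /forallP anti /forallP trans.
pose rk x := #|[set z | (z, x) \in L]|.
have rkP u w : rk u <= rk w -> (u, w) \in L.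
  apply: contraTT => uw; rewrite -ltnNge.
  have wu : (w, u) \in L by move: (forallP (tot u) w); rewrite (negPf uw).
  apply/proper_card/properP; split.
    apply/subsetP => z; rewrite !inE => zw.
    by move: (forallP (forallP (trans z) w) u); rewrite zw wu.
  by exists u; rewrite !inE //; move: (forallP (tot u) u); rewrite orbb.
exists rk => // u w E.
by move: (forallP (anti u) w); rewrite !rkP ?E //= => /eqP.
Qed.

Lemma wcol_rank (G : sgraph) r : exists (W : G -> {set G}) (rk : G -> nat),
  [/\ injective rk, forall v, #|W v| <= wcol r G
    & forall v u, reach rk r (rk u) v u -> u \in W v].
Proof.
rewrite /wcol; case: ex_minnP => c /existsP[pi /andP[piL /eqP cE]] _.
have [rk rk_inj rkP] := linear_order_rank piL.
exists (wreach pi r), rk; split=> // v; last by move=> u; apply: mem_wreach => w; apply: rkP.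
by rewrite -cE; apply: (leq_bigmax (F := fun v => #|wreach pi r v|)).
Qed.

Section Chains.
Context {d : Order.disp_t} (P : finPOrderType d).
Import Order.POrderTheory.

Lemma cover_path (x y : P) : (x <= y)%O -> exists p,
  [/\ path (fun a b => covers b a) x p, last x p = y & all (fun z => (x <= z <= y)%O) p].
Proof.
have [n] := ubnP #|[set z | (x < z <= y)%O]|; elim: n x => // n IH x cn xy.
have [<-|nxy] := eqVneq x y; first by exists [::].
have Iy : (x < y <= y)%O by rewrite lexx lt_def eq_sym nxy xy.
pose I := [pred z | (x < z <= y)%O].
(* A minimal element of the half-open interval covers [x]. *)
case: (@arg_minnP _ y I (fun z => #|[set a | (a <= z)%O]|) Iy) => z /andP[xz zy] zmin.
have zx : covers z x.
  rewrite /covers xz; apply/existsPn => a; apply/negP => /andP[xa az].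
  have := zmin a; rewrite /= xa (le_trans (ltW az)) // => /(_ isT); apply/negP.
  rewrite -ltnNge; apply/proper_card/properP; split.
    by apply/subsetP => a'; rewrite !inE => /le_trans; apply; apply: ltW.
  by exists z; rewrite !inE ?lexx // (lt_geF az).
have [|p [pp lp ap]] := IH z _ zy.
  rewrite ltnS in cn; apply: leq_trans cn; apply/proper_card/properP; split.
    apply/subsetP => a; rewrite !inE => /andP[za ->]; by rewrite (lt_trans xz).
  by exists z; rewrite !inE ?ltxx // xz.
exists (z :: p); rewrite /= zx (ltW xz) zy; split=> //.
by apply: sub_all ap => a /andP[za ->]; rewrite (le_trans (ltW xz)).
Qed.

Lemma cover_chain h (x y : cover_graph P) : height P <= h -> (x <= y :> P)%O -> exists p,
  [/\ path (@adj (cover_graph P)) x p, last x p = y, size p < h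
   & all (fun z : P => (x <= z)%O && (z <= y)%O) p].
Proof.
move=> hP xy; have [p [pp lp ap]] := cover_path xy; exists p; split=> //.
  by apply: sub_path pp => a b; rewrite /= /cover_adj orbC => ->.
have slt : sorted (fun a b : P => (a < b)%O) (x :: p).
  by apply: sub_path pp => a b /andP[].
have up : uniq (x :: p) by apply: sorted_uniq slt; [exact: lt_trans | exact: ltxx].
rewrite -[_.+1]/(size (x :: p)) -(card_uniqP up) -cardsE; apply: leq_trans hP.
apply: (leq_bigmax_cond (F := fun C : {set P} => #|C|)).
apply/forall_inP => a; rewrite inE => aC; apply/forall_inP => b; rewrite inE => bC.
have sle : sorted (fun a b : P => (a <= b)%O) (x :: p).
  by apply: sub_sorted slt => u v /ltW.
have mono u v : u \in x :: p -> v \in x :: p ->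
    index u (x :: p) <= index v (x :: p) -> (u <= v)%O.
  move=> uC vC uv; rewrite -(nth_index x uC) -(nth_index x vC).
  by apply: (sorted_leq_nth le_trans le_refl) => //; rewrite inE index_mem.
rewrite /Order.comparable.
have [l|/ltnW l] := leqP (index a (x :: p)) (index b (x :: p)).
  by rewrite mono.
by rewrite (mono b a) ?orbT.
Qed.

(** The same chain read downwards, for use with the converse order. *)
Lemma rev_cover_chain h (x y : cover_graph P) : height P <= h -> (y <= x :> P)%O -> exists p,
  [/\ path (@adj (cover_graph P)) x p, last x p = y, size p < h
   & all (fun z : P => (z <= x)%O && (y <= z)%O) p].
Proof.
move=> hP yx; have [p [pp lp sp /allP ap]] := cover_chain hP yx.
exists (rev (belast y p)); split=> //.
- rewrite -lp rev_path; apply: sub_path pp => a b.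
  by rewrite adj_sym.
- by case: p {pp sp ap} lp => [//|a p] _ /=; rewrite rev_cons last_rcons.
- by rewrite size_rev size_belast.
- apply/allP => z; rewrite mem_rev => /mem_belast; rewrite inE.
  by case/orP=> [/eqP->|/ap]; rewrite ?lexx ?yx // andbC.
Qed.

End Chains.

(** * The dimension bound *)

Definition candidate_exponent h t :=
  candidates_exponent t (t * t * (t * h) + 1) (list_size h t).

(** Write [b = 3 * c]. There are at most [b ^ (candidate_exponent h t + 2)]
    colours, one of them for each position in either list, and three bits, hence
    at most [b ^ 2] values, for each pair of positions. *)
Definition dim_exponent (ht : nat * nat) :=
  let K := list_size ht.1 ht.2 in
  (candidate_exponent ht.1 ht.2 + 2) * K * 2 + 2 * (K * K).

Section Poset.
Context {d : Order.disp_t} (P : finPOrderType d) (h t : nat).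
Hypothesis P_gt0 : 0 < #|P|.
Hypothesis height_P : height P <= h.
Hypothesis no_sub :
  ~ contains_le_subdivision ((2 * h)%:Z - 3)%R (complete_graph t) (cover_graph P).
Hypothesis t_gt1 : 1 < t.

Let G := cover_graph P.
Let le : rel G := fun x y => (x <= y :> P)%O.
Let ge : rel G := fun x y => le y x.

Lemma le_height (C : {set G}) : {in C &, forall x y, le x y || le y x} -> #|C| <= h.
Proof.
move=> CC; apply: leq_trans height_P.
apply: (leq_bigmax_cond (F := fun C : {set P} => #|C|)).
by apply/forall_inP => a aC; apply/forall_inP => b; apply: CC.
Qed.

Lemma ex_chains (R : rel G) :
  (forall x y, R x y -> exists p, [/\ path (@adj G) x p, last x p = y, size p < h
     & all (fun z => R x z && R z y) p]) ->
  exists ch : G -> G -> seq G, forall x y, R x y ->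
    [/\ path (@adj G) x (ch x y), last x (ch x y) = y, size (ch x y) < h
      & all (fun z => R x z && R z y) (ch x y)].
Proof.
move=> H; suff /fin_all_exists[ch chP] : forall xy : G * G, exists p, R xy.1 xy.2 ->
   [/\ path (@adj G) xy.1 p, last xy.1 p = xy.2, size p < h
      & all (fun z => R xy.1 z && R z xy.2) p].
  by exists (fun x y => ch (x, y)) => x y; apply: (chP (x, y)).
case=> x y; have [Rxy|nR] := boolP (R x y); last by exists [::] => Rxy; case/negP: nR.
by have [p pP] := H x y Rxy; exists p.
Qed.

Lemma poset_dim_bound :
  poset_dim P <= (3 * wcol (4 * h - 4) G) ^ dim_exponent (h, t).
Proof.
have le_refl : reflexive le by move=> x; apply: Order.POrderTheory.lexx.
have le_trans : transitive le by move=> y x z; apply: Order.POrderTheory.le_trans.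
have le_anti : antisymmetric le by move=> x y; apply: Order.POrderTheory.le_anti.
have ge_trans : transitive ge by move=> y x z yx zy; apply: le_trans zy yx.
have ge_anti : antisymmetric ge by move=> x y; rewrite andbC; apply: le_anti.
have [ch chP] : exists ch : G -> G -> seq G, forall x y, le x y ->
    [/\ path (@adj G) x (ch x y), last x (ch x y) = y, size (ch x y) < h
      & all (fun z => le x z && le z y) (ch x y)].
  by apply: ex_chains => x y; apply: cover_chain.
have [ch' chP'] : exists ch : G -> G -> seq G, forall x y, ge x y ->
    [/\ path (@adj G) x (ch x y), last x (ch x y) = y, size (ch x y) < h
      & all (fun z => ge x z && ge z y) (ch x y)].
  by apply: ex_chains => x y; apply: rev_cover_chain.
have ge_height (C : {set G}) : {in C &, forall x y, ge x y || ge y x} -> #|C| <= h.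
  by move=> CC; apply: le_height => x y xC yC; apply: CC.
have [W [rk [rk_inj cardW reachW]]] := wcol_rank G (4 * h - 4).
have {}reachW v u : reach rk (4 * h.-1) (rk u) v u -> u \in W v.
  by move=> r; apply: reachW; apply: reach_le r; lia.
set c := wcol _ G in cardW *.
have c_gt0 : 0 < c.
  have /card_gt0P[x _] := P_gt0; apply: leq_trans (cardW x); apply/card_gt0P; exists x.
  by apply: reachW; exists [::]; split=> //=; rewrite leqnn.
set b := 3 * c.
have b2 : 2 <= b by rewrite /b; lia.
have cb : c <= b by rewrite /b; lia.
have b0 : 0 < b by lia.
pose m := t * t * (t * h) + 1; pose K := list_size h t; pose g := candidate_exponent h t.
have mP : t * t * (t * h) * c <= b ^ m.
  rewrite /m expnD expn1 leq_mul //.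
  by apply: ltnW; apply: leq_trans (ltn_expl _ b2) _.
have [A [e [cardA eU eP]]] :=
  ex_small_cofinal_lists le_refl le_anti le_trans chP le_height no_sub t_gt1
    cardW reachW b2 cb mP.
have [B [f [cardB fV fP]]] :=
  ex_small_cofinal_lists (le_refl : reflexive ge) ge_anti ge_trans chP' ge_height
    no_sub t_gt1 cardW reachW b2 cb mP.
have [psiE psiEP] := conflict_coloring cardW cardA.
have [psiF psiFP] := conflict_coloring cardW cardB.
have chain := chain_reach le_refl chP (rk := rk).
pose sig := signature rk le A B e f psiE psiF.
apply: leq_trans (poset_dim_le_signature (sig := sig) _ _) _.
- by rewrite !(card_prod, card_ffun, card_ord, card_bool) !muln_gt0 !expn_gt0.
- move=> I /subsetP II sI.
  have Inle p : p \in I -> ~~ (p.1 <= p.2)%O.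
    by move/II; rewrite inE negb_or => /andP[].
  apply: reversible_of_no_cycle => // C /subsetP CI Csucc Cpred.
  apply: (equal_signature_no_cycle rk_inj le_refl le_trans chain reachW
    eU fV eP fP psiEP psiFP) => //.
  + by move=> p /CI; apply: Inle.
  + by move=> p q /CI pI /CI qI; apply: sI.
rewrite !(card_prod, card_ffun, card_ord, card_bool) -/K -/m -/g.
set N := _.*2.+1.
have NP : N <= b ^ (g + 2).
  rewrite /N -mul2n; apply: (@leq_trans (3 * (c * b ^ g))).
    have : 0 < c * b ^ g by rewrite muln_gt0 c_gt0 expn_gt0 b0.
    by rewrite -[candidates_exponent _ _ _]/g; lia.
  rewrite mulnA -/b addn2 !expnS leq_mul2l; apply/orP; right.
  by rewrite leq_pmull.
rewrite /dim_exponent /= -/K -/g expnD.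
apply: leq_mul.
  by rewrite muln2 -addnn expnD expnM leq_mul //; apply: leq_expl.
rewrite [b ^ _]expnM; apply: leq_expl; apply: (@leq_trans (3 ^ 2)) => //.
by apply: leq_expl; rewrite /b leq_pmulr.
Qed.

End Poset.

Theorem theorem5 :
  exists f : nat * nat -> nat,
  forall h t : nat, 1 <= h -> 1 <= t ->
  forall (d : Order.disp_t) (P : finPOrderType d),
    0 < #|P| ->
    height P <= h ->
    ~ contains_le_subdivision ((2 * h)%:Z - 3)%R (complete_graph t)
        (cover_graph P) ->
    poset_dim P <= (3 * wcol (4 * h - 4) (cover_graph P)) ^ f (h, t).
Proof.
exists dim_exponent => h t _ t_gt0 d P P_gt0 hP no_sub.
apply: poset_dim_bound => //; rewrite ltn_neqAle t_gt0 andbT.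
apply/eqP => t1; apply: no_sub; rewrite -t1.
exact: contains_complete1.
Qed.
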